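(* Let $\mathfrak G=(\mathfrak X,\mathfrak E)$ be a tree of bounded degree without dead ends, with boundary $\Omega$, and let $0\neq z\in\mathbb C$. Then the edge Poisson transform $\mathcal P_z^{\mathrm e}\colon\mathcal D'(\Omega)\to\mathrm{Maps}(\mathfrak E,\mathbb C)$ is injective with image $$\mathcal E_z(\Delta^{\mathrm e};\mathrm{Maps}(\mathfrak E,\mathbb C))=\{f\in\mathrm{Maps}(\mathfrak E,\mathbb C)\mid \Delta^{\mathrm e}f=zf\},$$ i.e. it is a linear isomorphism onto this eigenspace.
   Context: Graphs: $\mathfrak X$ is the set of vertices and $\mathfrak E\subseteq\mathfrak X^2$ the set of directed edges, symmetric under $(a,b)\mapsto(b,a)$, without loops $(x,x)$; the graph is connected. For $\vec e=(a,b)$ put $\iota(\vec e)=a$, $\tau(\vec e)=b$, $\vec e^{\,\mathrm{op}}=(b,a)$; $d$ is the graph distance. Bounded degree: the numbers of neighbors of vertices are finite and uniformly bounded. A tree has no circuits (after identifying opposite edges). No dead ends: every directed edge is the first edge of an infinite non-backtracking chain of concatenated edges. Edge Laplacian: $\Delta^{\mathrm e}f(\vec e)=\sum f(\vec e\,')$, the sum over all $\vec e\,'\in\mathfrak E$ with $\iota(\vec e\,')=\tau(\vec e)$ and $\vec e\,'\neq\vec e^{\,\mathrm{op}}$. Boundary: $\Omega$ is the set of equivalence classes of one-sided infinite non-backtracking vertex paths, two being equivalent if they share infinitely many vertices. For $x\in\mathfrak X$, $\omega\in\Omega$, $[x,\omega[$ is the representative of $\omega$ starting at $x$. $\partial_+\vec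 e\subseteq\Omega$ is the set of $\omega$ such that $[\iota(\vec e),\omega[$ starts with the edge $\vec e$. $\Omega$ has the topology generated by the sets $\partial_+\vec e$. $\mathcal D'(\Omega)$ is the algebraic dual of the space $C^{\mathrm{lc}}(\Omega)$ of locally constant functions $\Omega\to\mathbb C$; write $\int_\Omega f\,d\mu=\mu(f)$. Horocycle bracket: fix a base point $o\in\mathfrak X$. For $(x,\omega)$ let $y$ be the vertex with $[o,\omega[\,\cap\,[x,\omega[\,=[y,\omega[$ and put $\langle x,\omega\rangle=d(o,y)-d(x,y)$. Edge Poisson transform: $\mathcal P^{\mathrm e}_z(\mu)(\vec e)=\int_\Omega z^{\langle\iota(\vec e),\omega\rangle}\mathbb 1_{\partial_+\vec e}(\omega)\,d\mu(\omega)$. *)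

(* Defs.v *)
From HB Require Import structures.
From mathcomp Require Import all_boot all_order all_algebra.
From mathcomp Require Import all_classical all_reals all_analysis.
From mathcomp Require Import complex.

Set Implicit Arguments.
Unset Strict Implicit.
Unset Printing Implicit Defensive.

Import Order.TTheory GRing.Theory Num.Theory.

Local Open Scope classical_set_scope.
Local Open Scope ring_scope.

(* Connected graphs without loops or multiple edges, on a vertex set of
   arbitrary cardinality. *)
Record graph := Graph {
  vertex :> choiceType;
  adj : rel vertex;
  adj_sym : symmetric adj;
  adj_irr : irreflexive adj;
  adj_conn : forall x y : vertex,
    exists s : seq vertex, path adj x s /\ last x s = y }.

Section Graph.
Variable G : graph.

Definition edge : choiceType := {e : G * G | adj e.1 e.2}.

Definition iota_e (e : edge) : G := (val e).1.
Definition tau_e (e : edge) : G := (val e).2.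

Fact op_subproof (e : edge) : adj (tau_e e) (iota_e e).
Proof. by rewrite adj_sym; exact: (valP e). Qed.

Definition op_edge (e : edge) : edge :=
  exist (fun p : G * G => adj p.1 p.2) (tau_e e, iota_e e) (op_subproof e).

Definition follows (e e' : edge) : Prop := iota_e e' = tau_e e /\ e' <> op_edge e.

Definition bounded_degree : Prop :=
  exists k : nat, forall x : G, ([set y | adj x y] #<= `I_k)%card.

(* A circuit is a cyclic sequence of at least three distinct vertices, each
   adjacent to the next; the cycles of [path] with one or two vertices are
   loops and edges traversed back and forth, respectively. *)
Definition is_tree : Prop :=
  forall c : seq G, cycle (@adj G) c -> uniq c -> (size c < 3)%N.

Definition no_dead_ends : Prop :=
  forall e : edge, exists c : nat -> edge,
    c 0%N = e /\ forall n, follows (c n) (c n.+1).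

Fact dist_subproof (x y : G) : exists n : nat,
  `[< exists s : seq G, [/\ path (@adj G) x s, last x s = y & size s = n] >].
Proof.
by have [s [xs sy]] := adj_conn x y; exists (size s); apply/asboolP; exists s.
Qed.

Definition dist (x y : G) : nat := ex_minn (dist_subproof x y).

Definition nb_path (p : nat -> G) : Prop :=
  (forall n, adj (p n) (p n.+1)) /\ (forall n, p n.+2 <> p n).

Definition path_equiv (p q : nat -> G) : Prop :=
  infinite_set (range p `&` range q).

Definition path_class (p : nat -> G) : set (nat -> G) :=
  [set q | nb_path q /\ path_equiv p q].

Definition boundary : Type :=
  {A : set (nat -> G) | exists2 p, nb_path p & A = path_class p}.

(* [x, w[; in a tree the set below has exactly one element, and the default
   value is not used. *)
Definition ray (x : G) (w : boundary) : nat -> G :=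
  xget (fun=> x) [set p | sval w p /\ p 0%N = x].

Definition dplus (e : edge) : set boundary :=
  [set w | ray (iota_e e) w 0%N = iota_e e /\ ray (iota_e e) w 1%N = tau_e e].

(* The vertex y with [o, w[ `&` [x, w[ = [y, w[, as sets of vertices; in a tree
   it exists and is unique. *)
Definition confluent (o x : G) (w : boundary) : G :=
  xget o [set y | range (ray o w) `&` range (ray x w) = range (ray y w)].

Definition bracket (o x : G) (w : boundary) : int :=
  (dist o (confluent o x w))%:Z - (dist x (confluent o x w))%:Z.

HB.instance Definition _ := gen_eqMixin boundary.
HB.instance Definition _ := gen_choiceMixin boundary.
HB.instance Definition _ :=
  isSubBaseTopological.Build boundary (range dplus) id.

End Graph.

Section Distributions.
Variables (R : realType) (G : graph).

(* Scalars as a module over themselves: R[i] alone is also an R-module. *)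
Local Notation C := (R[i]^o).

Definition edge_maps : lmodType R[i] := edge G -> C.

Definition edge_laplacian (f : edge_maps) : edge_maps :=
  fun e => \sum_(e' \in [set e' | follows e e']) f e'.

Definition loc_const : {pred (boundary G -> C)} :=
  fun f => `[< forall w, \forall w' \near w, f w' = f w >].

Fact loc_const_submod : submod_closed loc_const.
Proof.
split=> [|a f g /asboolP fP /asboolP gP]; apply/asboolP => w.
  by near=> w'.
near=> w'.
rewrite /= !fctE; congr (_ *: _ + _); first by near: w'; exact: fP.
by near: w'; exact: gP.
Unshelve. all: by end_near. Qed.
HB.instance Definition _ :=
  GRing.isSubmodClosed.Build _ _ loc_const loc_const_submod.

Definition lc_fun := {f : boundary G -> C | f \in loc_const}.
HB.instance Definition _ := SubChoice.on lc_fun.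
HB.instance Definition _ := [SubChoice_isSubLmodule of lc_fun by <:].

Definition is_linear : {pred (lc_fun -> C)} := fun mu => `[< linear mu >].

Fact is_linear_submod : submod_closed is_linear.
Proof.
split=> [|a mu nu /asboolP muP /asboolP nuP]; apply/asboolP => b f g.
  by rewrite /= scaler0 addr0.
rewrite /= !fctE muP nuP !scalerDr !scalerA mulrC -!addrA; congr (_ + _).
by rewrite addrCA.
Qed.
HB.instance Definition _ :=
  GRing.isSubmodClosed.Build _ _ is_linear is_linear_submod.

(* D'(Omega): all linear functionals, without any continuity. *)
Definition lc_dual := {mu : lc_fun -> C | mu \in is_linear}.
HB.instance Definition _ := SubChoice.on lc_dual.
HB.instance Definition _ := [SubChoice_isSubLmodule of lc_dual by <:].

(* The integral of f with respect to mu is mu f for locally constant f, and 0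
   by convention for any other f. *)
Definition lc_integral (mu : lc_dual) (f : boundary G -> C) : C :=
  val mu (insubd (0 : lc_fun) f).

(* In a tree the integrand below is locally constant, hence the convention on
   [lc_integral] plays no role. *)
Definition edge_poisson (o : G) (z : R[i]) (mu : lc_dual) : edge_maps :=
  fun e => lc_integral mu
    (fun w => z ^ bracket o (iota_e e) w * \1_(dplus e) w).

End Distributions.

(* Main.v *)
From HB Require Import structures.
Require Import Defs.
From mathcomp Require Import all_boot all_order all_algebra.
From mathcomp Require Import all_classical all_reals all_analysis.
From mathcomp Require Import complex.
From mathcomp Require Import finmap zify.

(* Call an edge outward of level [n] if it is the [n]-th edge of a ray issued
   from the base point [o]. Two non-backtracking paths of a tree with the same
   start never meet again once they have separated, so that the level [n]
   outward edges [e] cut the boundary into the finitely many clopen sets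
   [dplus e], on which the Poisson kernel of [e] equals [z ^+ n]. By Koenig's
   lemma every locally constant function is constant on these pieces for some
   [n], hence is a combination of Poisson kernels: the transform is injective.
   Since the bracket increases by one along each step of a ray, the kernels
   satisfy the eigenvalue equation. Conversely, for an eigenfunction [f] the
   weights [f e / z ^+ n] are additive under refinement of the pieces, so they
   define a distribution; its transform agrees with [f] on outward edges, and
   the eigenvalue equation propagates the equality to the inward edges [e] by
   induction on the level of [op_edge e]. *)

Set Implicit Arguments.
Unset Strict Implicit.
Unset Printing Implicit Defensive.

Import Order.TTheory GRing.Theory Num.Theory.

Local Open Scope classical_set_scope.
Local Open Scope ring_scope.

(** * Non-backtracking paths and rays in a tree *)

Section NonBacktracking.
Variable G : graph.
Hypothesis Gtree : is_tree G.
Local Open Scope nat_scope.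

Lemma path_map_iota (s : nat -> G) i m :
  (forall k, i <= k < i + m -> adj (s k) (s k.+1)) ->
  path (@adj G) (s i) (map s (iota i.+1 m)).
Proof.
elim: m i => [//|m IHm] i sP /=; rewrite sP; last by lia.
by apply: IHm => k Hk; apply: sP; lia.
Qed.

(** Strong induction on the length of a closed piece: shorter ones being excluded, its vertices are
    distinct, so in a tree its length is 1 or 2. The first is a loop, the second a backtracking
    step. *)
Lemma walk_neq (s : nat -> G) n :
  (forall k, k < n -> adj (s k) (s k.+1)) ->
  (forall k, k.+1 < n -> s k.+2 <> s k) ->
  forall i j, i < j <= n -> s i <> s j.
Proof.
move=> sadj snb i j ijn.
rewrite (_ : j = i + (j - i.+1).+1); last by lia.
have : i + (j - i.+1).+1 <= n by lia.
move: (j - i.+1) => d {j ijn}; elim/ltn_ind: d i => d IHd i idn sij.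
have : (size (map s (iota i d.+1)) < 3).
  apply: Gtree.
    rewrite /= {2}sij.
    have -> : rcons (map s (iota i.+1 d)) (s (i + d.+1)) =
        map s (iota i.+1 d.+1).
      by rewrite -[d.+1]addn1 iotaD map_cat /= cats1 addSnnS addn1.
    by apply: (@path_map_iota s i d.+1) => k kd; apply: sadj; lia.
  rewrite map_inj_in_uniq ?iota_uniq// => a b.
  have lt_neq a' b' : i <= a' -> a' < b' -> b' <= i + d -> s a' <> s b'.
    move=> ia ab bd; rewrite (_ : b' = a' + (b' - a'.+1).+1); last by lia.
    by apply: IHd; lia.
  rewrite !mem_iota => aP bP sab.
  change nat in a, b.
  case: (ltngtP a b) => // ab.
    by case: (lt_neq a b) => //; lia.
  by case: (lt_neq b a) => //; lia.
rewrite size_map size_iota => d2.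
have [d0|d1] : d = 0 \/ d = 1 by lia.
  rewrite d0 addn1 in sij idn.
  by move: (sadj i idn); rewrite -sij adj_irr.
by apply: (snb i); [lia|rewrite sij d1 addn2].
Qed.

Lemma nb_path_shift (p : nat -> G) n :
  nb_path p -> nb_path (fun k => p (n + k)).
Proof. by move=> [pa pn]; split=> k; rewrite !addnS. Qed.

Lemma nb_path_inj (p : nat -> G) : nb_path p -> injective p.
Proof.
move=> [pa pn] a b pab; case: (ltngtP a b) => // ab.
  by case: (@walk_neq p b (fun k _ => pa k) (fun k _ => pn k) a b) => //; lia.
by case: (@walk_neq p a (fun k _ => pa k) (fun k _ => pn k) b a) => //; lia.
Qed.

Definition path_cons (x : G) (p : nat -> G) n := if n is k.+1 then p k else x.

Lemma nb_path_cons x (p : nat -> G) :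
  nb_path p -> adj x (p 0) -> p 1 <> x -> nb_path (path_cons x p).
Proof. by move=> [pa pn] xp p1x; split=> -[|k] /=. Qed.

(* If the paths separate, running backwards along [q] and then along [p] gives a
   closed non-backtracking walk. *)
Lemma nb_path_meet (p q : nat -> G) n m : nb_path p -> nb_path q ->
  p 0 = q 0 -> p n = q m -> n = m /\ forall k, k <= n -> p k = q k.
Proof.
elim: n m p q => [|n IHn] [|m] p q np nq pq0 pqn.
- by split=> // -[].
- by move: pqn; rewrite pq0 => /(nb_path_inj nq).
- by move: pqn; rewrite -pq0 => /(nb_path_inj np).
case: (pselect (p 1 = q 1)) => [pq1|pq1].
  have [nm IH] := IHn m _ _ (nb_path_shift 1 np) (nb_path_shift 1 nq) pq1 pqn.
  by split; [rewrite nm|case=> // k; apply: IH].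
exfalso; pose s k := if k <= m.+1 then q (m.+1 - k) else p (k - m.+1).
have sp k : m.+1 <= k -> s k = p (k - m.+1).
  rewrite /s => mk; case: ifP => // km; have -> : k = m.+1 by lia.
  by rewrite subnn pq0.
have sq k : k <= m.+1 -> s k = q (m.+1 - k) by rewrite /s => ->.
case: (@walk_neq s (m.+1 + n.+1) _ _ 0 (m.+1 + n.+1)).
- move=> k _; case: (leqP m.+1 k) => mk.
    by rewrite !sp ?leqW// subSn//; apply: np.1.
  rewrite !sq ?(ltnW mk)// adj_sym.
  rewrite (_ : m.+1 - k = (m.+1 - k.+1).+1); last by lia.
  exact: nq.1.
- move=> k _; case: (leqP m.+1 k) => mk.
    by rewrite !sp ?leqW// !subSn ?leqW//; apply: np.2.
  case: (ltnP k.+1 m.+1) => mk1.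
    rewrite !sq ?(ltnW mk)//.
    by rewrite (_ : m.+1 - k = (m.+1 - k.+2).+2); [apply/nesym/nq.2|lia].
  (* At the turning point, not backtracking means [p 1 <> q 1]. *)
  have -> : k = m by lia.
  rewrite (sp m.+2)// (sq m)// (_ : m.+2 - m.+1 = 1); last by lia.
  by rewrite (_ : m.+1 - m = 1); last by lia.
- by lia.
by rewrite sq// sp ?leq_addr// subn0 addKn.
Qed.

(** Infinitely many shared vertices give shared ones arbitrarily far along both paths, and between
    two of these [nb_path_meet] makes the paths coincide. Conversely, a common tail is infinite by
    injectivity. *)
Lemma path_equiv_tail (p q : nat -> G) : nb_path p -> nb_path q ->
  path_equiv p q <-> exists i j, forall k, p (i + k) = q (j + k).
Proof.
move=> np nq; split=> [pq|[i [j pq]]]; last first.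
  apply: (@sub_infinite_set _ (range (fun k => p (i + k)))).
    by move=> _ [k _ <-]; split; [exists (i + k)|exists (j + k)].
  apply/infiniteP; have pinj : {in setT &, injective (fun k => p (i + k))}.
    by move=> a b _ _ /(nb_path_inj np)/addnI.
  by have := inj_card_eq pinj; rewrite card_eq_le => /andP[].
have far i j : exists a b, [/\ i <= a, j <= b & p a = q b].
  have fin : finite_set (p @` `I_i `|` q @` `I_j).
    by rewrite finite_setU; split; exact/finite_image/finite_II.
  have /infinite_setN0[v [[[a _ av] [b _ bv]] nv]] := infinite_setD pq fin.
  exists a, b; split; last by rewrite av.
    by rewrite leqNgt; apply/negP => ai; apply: nv; left; exists a.
  by rewrite leqNgt; apply/negP => bj; apply: nv; right; exists b.
have [i [j [_ _ pqij]]] := far 0 0.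
exists i, j => k; have [a [b [ai bj pqab]]] := far (i + k) j.
have [] := @nb_path_meet _ _ (a - i) (b - j)
  (nb_path_shift i np) (nb_path_shift j nq).
- by rewrite !addn0.
- by rewrite !subnKC//; lia.
by move=> _ ->//; lia.
Qed.

Lemma mem_nb_path (w : boundary G) p : sval w p -> nb_path p.
Proof. by case: w => A /= [q nq ->] []. Qed.

Lemma mem_tail (w : boundary G) p q : sval w p -> sval w q ->
  exists i j, forall k, p (i + k) = q (j + k).
Proof.
case: w => A /= [r nr ->] [np /(path_equiv_tail nr np)[i [j rp]]].
move=> [nq /(path_equiv_tail nr nq)[i' [j' rq]]].
exists (j + i'), (j' + i) => k.
by rewrite -!addnA -rp -rq addnCA.
Qed.

Lemma tail_mem (w : boundary G) p q i j : sval w p -> nb_path q ->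
  (forall k, p (i + k) = q (j + k)) -> sval w q.
Proof.
case: w => A /= [r nr ->] [np /(path_equiv_tail nr np)[i' [j' rp]]] nq pq.
split=> //; apply/(path_equiv_tail nr nq).
exists (i' + i), (j + j') => k.
by rewrite -!addnA rp addnCA pq.
Qed.

Lemma mem_start_inj (w : boundary G) p q :
  sval w p -> sval w q -> p 0 = q 0 -> p = q.
Proof.
move=> wp wq pq0; have [i [j pq]] := mem_tail wp wq.
apply: boolp.funext => k.
have [_ -> //] := nb_path_meet (mem_nb_path wp) (mem_nb_path wq) pq0 (pq k).
by rewrite leq_addl.
Qed.

(** Some representative of [w] is carried along a walk to [x], one edge at a time, by dropping its
    first vertex or prepending a new one; hence [ray] never takes its default value. *)
Lemma ray_mem_start x (w : boundary G) : sval w (ray x w) /\ ray x w 0 = x.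
Proof.
suff : exists p, sval w p /\ p 0 = x.
  by move=> pP; rewrite /ray; case: xgetP => [p _ //|] => nP; case: pP => p /nP.
have [p wp] : exists p, sval w p.
  case: w => A /= [p np ->]; exists p; split=> //.
  by apply/(path_equiv_tail np np); exists 0, 0.
have [s [xs xp]] := adj_conn x (p 0).
elim: s x xs xp => [|y s IHs] x /=; first by move=> _ ->; exists p.
move=> /andP[xy ys] sp; have [q [wq q0]] := IHs _ ys sp.
have nq := mem_nb_path wq.
case: (pselect (q 1 = x)) => [q1|q1].
  exists (fun k => q (1 + k)); split=> //.
  by apply: (@tail_mem w q _ 1 0 wq) => //; apply: nb_path_shift.
exists (path_cons x q); split=> //.
by apply: (@tail_mem w q _ 0 1 wq) => //; apply: nb_path_cons => //; rewrite q0.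
Qed.

Lemma ray_mem (x : G) w : sval w (ray x w).
Proof. by have [] := ray_mem_start x w. Qed.

Lemma ray0 (x : G) w : ray x w 0 = x.
Proof. by have [] := ray_mem_start x w. Qed.

Lemma nb_ray (x : G) w : nb_path (ray x w).
Proof. exact: mem_nb_path (ray_mem x w). Qed.

Lemma ray_uniq (x : G) w p : sval w p -> p 0 = x -> ray x w = p.
Proof.
by move=> wp p0; apply: (mem_start_inj (ray_mem x w) wp); rewrite ray0.
Qed.

Lemma nb_path_ray (p : nat -> G) : nb_path p -> exists w, ray (p 0) w = p.
Proof.
move=> np; exists (exist _ (path_class p) (ex_intro2 _ _ p np erefl)).
apply: ray_uniq => //=; split=> //.
by apply/(path_equiv_tail np np); exists 0, 0.
Qed.

Lemma ray_shift (x : G) w n k : ray (ray x w n) w k = ray x w (n + k).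
Proof.
rewrite (@ray_uniq _ _ (fun k => ray x w (n + k))) ?addn0//.
apply: (@tail_mem w (ray x w) _ n 0 (ray_mem x w)) => //.
exact/nb_path_shift/nb_ray.
Qed.

Lemma ray_cons (x y : G) w k :
  adj x y -> ray y w 1 <> x -> ray x w k.+1 = ray y w k.
Proof.
move=> xy yx; rewrite (@ray_uniq x w (path_cons x (ray y w)))//.
apply: (@tail_mem w (ray y w) _ 0 1 (ray_mem y w)) => //.
by apply: nb_path_cons; rewrite ?ray0//; apply: nb_ray.
Qed.

Lemma ray_meet (x : G) w w' n m :
  ray x w n = ray x w' m -> n = m /\ forall k, k <= n -> ray x w k = ray x w' k.
Proof. by apply: nb_path_meet; rewrite ?ray0//; apply: nb_ray. Qed.

(** An initial segment followed by a ray that does not turn back is again a ray: the vertices of the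
    segment are prepended one by one. *)
Lemma ray_cat (x : G) w w' n : ray (ray x w n) w' 1 = ray x w n.+1 ->
  ray x w' n.+1 = ray x w n.+1.
Proof.
elim: n x => [|n IHn] x; first by rewrite ray0.
have xS m : ray x w m.+1 = ray (ray x w 1) w m by rewrite ray_shift.
rewrite (xS n) (xS n.+1) => /IHn IH; rewrite -IH.
have [_ /(_ 1 isT) w'1] := ray_meet IH.
have [xadj xnb] := nb_ray x w.
apply: ray_cons; first by rewrite -[x in adj x _](ray0 x w).
by rewrite w'1 -(xS 1) -[x in _ <> x](ray0 x w).
Qed.

End NonBacktracking.

(** * Distances and the horocycle bracket along rays *)

Section Bracket.
Variable G : graph.
Hypothesis Gtree : is_tree G.
Local Open Scope nat_scope.

Lemma ray_meet_shift (x y : G) w i j :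
  ray x w i = ray y w j -> forall k, ray x w (i + k) = ray y w (j + k).
Proof. by move=> ij k; rewrite -!ray_shift// ij. Qed.

Lemma ray_meet_tail (x y : G) w : exists i j, ray x w i = ray y w j.
Proof.
have [i [j /(_ 0)]] := mem_tail Gtree (ray_mem Gtree x w) (ray_mem Gtree y w).
by rewrite !addn0; exists i, j.
Qed.

(** Past a meeting point both rays advance in step, so the difference of positions is the same at
    every meeting point; it will be the bracket. *)
Lemma ray_meet_diff (x y : G) w i j i' j' :
  ray x w i = ray y w j -> ray x w i' = ray y w j' -> i + j' = i' + j.
Proof.
wlog ii' : i j i' j' / i <= i'.
  move=> H ij ij'; case: (leqP i i') => ii'; first exact: H ij ij'.
  by apply/esym; apply: H ij' ij; apply: ltnW.
move=> /ray_meet_shift/(_ (i' - i)); rewrite subnKC// => ->.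
by move=> /(ray_meet Gtree)[]; lia.
Qed.

(** Moving the start of a ray to a neighbour shifts positions by one, up or down. The case [j = 0]
    is the lower bound in [dist_ray]. *)
Lemma size_path_ray (x : G) w s i j : path (@adj G) x s ->
  ray x w i = ray (last x s) w j -> i <= j + size s.
Proof.
elim: s x i j => [|a s IHs] x i j /=.
  by move=> _ /(ray_meet Gtree)[->]; rewrite addn0.
move=> /andP[xa as_]; case: (pselect (ray a w 1 = x)) => [a1|a1] ij.
  suff : i.+1 <= j + size s by lia.
  by apply: IHs as_ _; rewrite -ij -a1 ray_shift// add1n.
rewrite addnS -addSn; apply: IHs as_ _.
rewrite -(ray_cons Gtree i xa a1) -addn1 -(addn1 j).
exact: ray_meet_shift.
Qed.

Lemma dist_ray (x : G) w n : dist x (ray x w n) = n.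
Proof.
rewrite /dist; case: ex_minnP => m /asboolP[s [xs sl <-]] mmin.
apply/eqP; rewrite eqn_leq; apply/andP; split; last first.
  by rewrite -(add0n (size s)); apply: size_path_ray xs _; rewrite sl ray0.
apply: mmin; apply/asboolP; exists (map (ray x w) (iota 1 n)); split.
- rewrite -[x in path _ x _](ray0 Gtree x w); apply: path_map_iota => k _.
  exact: (nb_ray Gtree x w).1.
- case: (n) => [|k]; first by rewrite /= ray0.
  by rewrite -[X in iota _ X]addn1 iotaD map_cat last_cat /= add1n.
by rewrite size_map size_iota.
Qed.

Lemma confluent_ray (o x : G) w : exists i j,
  ray o w i = ray x w j /\ confluent o x w = ray o w i.
Proof.
have ex : exists i, `[< exists j, ray o w i = ray x w j >].
  by have [i ij] := ray_meet_tail o x w; exists i; apply/asboolP.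
(* The confluent vertex is the first vertex of the ray from [o] that lies on the ray from [x]. *)
case: (ex_minnP ex) => i /asboolP[j ij] imin; exists i, j; split=> //.
set y := ray o w i.
have range_y : range (ray o w) `&` range (ray x w) = range (ray y w).
  apply/seteqP; split=> [v [[a _ av] [b _ bv]]|_ [k _ <-]]; last first.
    rewrite {1}/y ray_shift//; split; first by exists (i + k).
    by rewrite (ray_meet_shift ij); exists (j + k).
  have ia : i <= a by apply: imin; apply/asboolP; exists b; rewrite av.
  by exists (a - i) => //; rewrite ray_shift// subnKC.
(* Two rays to [w] with the same range pass through each other's starts; injectivity makes both
   offsets zero. *)
apply: xget_unique => // y'; rewrite /= range_y => yy'.
have [a _ ay] : range (ray y' w) y by rewrite -yy'; exists 0; rewrite ?ray0.
have [b _ by'] : range (ray y w) y' by rewrite yy'; exists 0; rewrite ?ray0.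
have : ray y w (b + a) = ray y w 0 by rewrite -ray_shift// by' ay ray0.
move=> /(nb_path_inj Gtree (nb_ray Gtree y w))/eqP.
rewrite addn_eq0 => /andP[/eqP b0 _].
by rewrite -by' b0 ray0.
Qed.

(** Any meeting point computes the bracket, not only the confluent vertex, by [ray_meet_diff]. *)
Lemma bracketE (o x : G) w i j : ray o w i = ray x w j ->
  bracket o x w = (i%:Z - j%:Z)%R.
Proof.
move=> ij; have [i' [j' [ij' cE]]] := confluent_ray o x w.
rewrite /bracket cE dist_ray ij' dist_ray.
by have := ray_meet_diff ij ij'; lia.
Qed.

Lemma dplusE (e : edge G) w : dplus e w <-> ray (iota_e e) w 1 = tau_e e.
Proof. by rewrite /dplus /= ray0//; split=> [[]|]. Qed.

Lemma ray_dplus (e : edge G) w k :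
  dplus e w -> ray (iota_e e) w k.+1 = ray (tau_e e) w k.
Proof. by move=> /dplusE <-; rewrite ray_shift. Qed.

Lemma bracket_tau (o : G) (e : edge G) w : dplus e w ->
  bracket o (tau_e e) w = (bracket o (iota_e e) w + 1)%R.
Proof.
move=> ew; have [i [j ij]] := ray_meet_tail o (iota_e e) w.
(* Advancing by one vertex keeps the meeting point on the ray from [tau_e e] even if [j = 0]. *)
have := ray_meet_shift ij 1; rewrite !addn1 ray_dplus// => /bracketE ->.
by rewrite (bracketE ij); lia.
Qed.

End Bracket.

(** * The topology of the boundary *)

Section Boundary.
Variable G : graph.
Hypothesis Gtree : is_tree G.
Local Open Scope nat_scope.

Lemma edge_at_subproof (o : G) w n :
  adj (ray o w n, ray o w n.+1).1 (ray o w n, ray o w n.+1).2.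
Proof. exact: (nb_ray Gtree o w).1. Qed.

Definition edge_at (o : G) w n : edge G :=
  exist (fun p : G * G => adj p.1 p.2) _ (edge_at_subproof o w n).

Lemma edge_inj (e e' : edge G) :
  iota_e e = iota_e e' -> tau_e e = tau_e e' -> e = e'.
Proof.
case: e e' => [[a b] ab] [[a' b'] ab']; rewrite /iota_e /tau_e /= => aa bb.
by apply: val_inj; rewrite /= aa bb.
Qed.

Lemma dplus_edge_at (o : G) w w' n :
  dplus (edge_at o w n) w' <-> ray o w' n.+1 = ray o w n.+1.
Proof.
split=> [/(dplusE Gtree)/(ray_cat Gtree)//|ww'].
have [_ /(_ _ (leqnSn n)) wn] := ray_meet Gtree ww'.
apply/(dplusE Gtree); change (ray (ray o w n) w' 1 = ray o w n.+1).
by rewrite -wn ray_shift// addn1.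
Qed.

Lemma open_dplus (e : edge G) : open (dplus e).
Proof.
exists [set dplus e]; last by rewrite bigcup_set1.
move=> _ ->; exists [fset dplus e]%fset.
  by move=> A /fset1P ->; apply/mem_set; exists e.
by rewrite set_fset1 bigcap_set1.
Qed.

Lemma near_ray (x : G) w n : \forall w' \near w, ray x w' n = ray x w n.
Proof.
case: n => [|n]; first by near=> w'; rewrite !ray0.
apply: filterS (open_nbhs_nbhs (conj (open_dplus (edge_at x w n)) _)).
  by move=> w' /dplus_edge_at.
exact/dplus_edge_at.
Unshelve. all: by end_near. Qed.

(** Each subbasic set containing [w] is decided by a finite piece of the ray from [o]; for a finite
    intersection the maximum of the lengths serves. *)
Lemma nbhs_ray (o : G) w (A : set (boundary G)) : nbhs w A ->
  exists n, forall w', ray o w' n = ray o w n -> A w'.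
Proof.
have base e : dplus e w ->
    exists n, forall w', ray o w' n = ray o w n -> dplus e w'.
  have [i [j ij]] := ray_meet_tail Gtree o (iota_e e) w.
  (* One vertex past the meeting point, so that the direction in which [w'] leaves it is known. *)
  move=> /(dplusE Gtree) e1; exists i.+1 => w' ww'; apply/(dplusE Gtree).
  have [_ /(_ _ (leqnSn i)) wi] := ray_meet Gtree ww'.
  suff /(ray_meet Gtree)[_ ->//] :
    ray (iota_e e) w' j.+1 = ray (iota_e e) w j.+1.
  apply: ray_cat => //; rewrite -ij -wi ray_shift// addn1 ww'.
  by have := ray_meet_shift Gtree ij 1; rewrite !addn1.
rewrite nbhsE => -[B [[D sD <-] [C DC Cw]] BA].
have [F sF FC] := sD _ DC.
have {}base (E : set (boundary G)) : exists n, E \in F ->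
    forall w', ray o w' n = ray o w n -> E w'.
  have [EF|EF] := boolP (E \in F); last by exists 0.
  have /set_mem[e _ eE] := sF _ EF; rewrite /= in eE.
  have Ew : E w by rewrite -FC in Cw; apply: Cw.
  by subst E; have [n nP] := base e Ew; exists n.
have [N NP] := choice base.
exists (\max_(E <- F) N E) => w' ww'; apply: BA; exists C => //.
change (C w'); rewrite -FC => E /= EF; apply: (NP E EF).
by have [_ ->//] := ray_meet Gtree ww'; exact: leq_bigmax_seq.
Qed.

End Boundary.

(** * Finiteness from bounded degree *)

Section Finiteness.
Variable G : graph.
Hypotheses (Gtree : is_tree G) (Gbounded : bounded_degree G).
Local Open Scope nat_scope.

Lemma finite_neighbors (x : G) : finite_set [set y | adj x y].
Proof.
by have [k kP] := Gbounded; apply: card_le_finite (kP x) (finite_II k).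
Qed.

Lemma finite_sphere (o : G) n : finite_set (range (fun w => ray o w n)).
Proof.
elim: n => [|n IHn].
  by apply: (@sub_finite_set _ _ [set o]) => // _ [w _ <-]; rewrite ray0.
apply: sub_finite_set (bigcup_finite IHn (fun x _ => finite_neighbors x)).
move=> _ [w _ <-]; exists (ray o w n); first by exists w.
exact: (nb_ray Gtree o w).1.
Qed.

Lemma finite_edges (A : set G) (E : set (edge G)) : finite_set A ->
  (forall e, E e -> A (iota_e e)) -> finite_set E.
Proof.
move=> finA EA; pose B := \bigcup_(x in A) [set y | adj x y].
have finB : finite_set B.
  by apply: bigcup_finite => // x _; apply: finite_neighbors.
apply: sub_finite_set (_ : finite_set (val @^-1` (A `*` B))); last first.
  by apply: finite_preimage (finite_setX finA finB) => a b _ _; apply: val_inj.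
move=> e Ee; split; first exact: EA.
by exists (iota_e e); [exact: EA|exact: (valP e)].
Qed.

Definition level_edges (o : G) n : set (edge G) :=
  range (fun w => edge_at Gtree o w n).

Lemma finite_level_edges (o : G) n : finite_set (level_edges o n).
Proof.
by apply: (finite_edges (finite_sphere o n)) => _ [w _ <-]; exists w.
Qed.

Lemma finite_follows (e : edge G) : finite_set [set e' | follows e e'].
Proof. by apply: (@finite_edges [set tau_e e]) => // e' []. Qed.

(* Koenig's lemma stands in for the compactness of the boundary. *)
Lemma loc_const_ray (T : Type) (g : boundary G -> T) (o : G) :
  (forall w, \forall w' \near w, g w' = g w) ->
  exists n, forall w w', ray o w n = ray o w' n -> g w = g w'.
Proof.
move=> gP; apply: contrapT => /forallNP bad0.
(* No level [N] works for [g] on the cylinder of ends that agree with [w] at vertex [n]. *)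
pose bad n w := forall N, exists w1 w2, [/\ ray o w1 n = ray o w n,
  ray o w2 n = ray o w n, ray o w1 N = ray o w2 N & g w1 <> g w2].
have badS n w : bad n w -> exists w', ray o w' n = ray o w n /\ bad n.+1 w'.
  move=> badw; apply: contrapT => /forallNP good.
  have /choice[N NP] : forall y, exists N, forall w1 w2,
      ray o w1 n = ray o w n -> ray o w1 n.+1 = y -> ray o w2 n.+1 = y ->
      ray o w1 N = ray o w2 N -> g w1 = g w2.
    move=> y.
    case: (pselect (exists w', ray o w' n = ray o w n /\ ray o w' n.+1 = y)).
      move=> [w' [w'n w'y]]; have /not_andP[//|/existsNP[N NP]] := good w'.
      exists N => w1 w2 _ w1y w2y w12; apply: contrapT => g12.
      by apply: NP; exists w1, w2; rewrite w'y.
    by move=> H; exists 0 => w1 w2 w1n w1y; case: H; exists w1.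
  (* The term [n.+1] puts [w1] and [w2] into one subcylinder; the maximum, over a finite sphere,
     dominates the level that works there. *)
  have [w1 [w2 [w1n w2n w12 g12]]] :=
    badw (n.+1 + \max_(y <- fset_set (range (fun w => ray o w n.+1))) N y).
  apply: g12; have [_ agree] := ray_meet Gtree w12.
  apply: (NP (ray o w1 n.+1)) => //; first by rewrite -agree// leq_addr.
  apply: agree; apply: leq_trans (leq_addl _ _).
  apply: leq_bigmax_seq => //; rewrite in_fset_set; last exact: finite_sphere.
  by apply/mem_set; exists w1.
have [w0 bad0w] : exists w0, bad 0 w0.
  have [w0 _] : exists w0 : boundary G, True.
    by have /existsNP[w _] := bad0 0; exists w.
  exists w0 => N.
  have /existsNP[w1 /existsNP[w2 /not_implyP[w12 g12]]] := bad0 N.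
  by exists w1, w2; rewrite !ray0.
have /choice[F FP] : forall nw : nat * boundary G, exists w', bad nw.1 nw.2 ->
    ray o w' nw.1 = ray o nw.2 nw.1 /\ bad nw.1.+1 w'.
  move=> [n w] /=; case: (pselect (bad n w)) => [/badS[w' ?]|].
    by exists w'.
  by move=> nbad; exists w.
(* The nested bad cylinders shrink to an end [w], the class of the diagonal path; [g] is constant
   near [w], a contradiction. *)
pose W := fix W n := if n is k.+1 then F (k, W k) else w0.
have badW n : bad n (W n) by elim: n => //= n /(FP (n, W n))[].
have WS n : ray o (W n.+1) n = ray o (W n) n by have [] := FP (n, W n) (badW n).
have WSS n : ray o (W n.+2) n = ray o (W n) n.
  by have [_ ->//] := ray_meet Gtree (WS n.+1).
have np : nb_path (fun n => ray o (W n) n).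
  split=> n; first by rewrite -(WS n); apply: (nb_ray Gtree o (W n.+1)).1.
  by rewrite -(WSS n); apply: (nb_ray Gtree o (W n.+2)).2.
have [w wP] := nb_path_ray Gtree np; rewrite ray0// in wP.
have [n nP] := nbhs_ray Gtree o (gP w).
have [w1 [w2 [w1n w2n _]]] := badW n 0; apply.
by rewrite !nP//= ?w1n ?w2n wP.
Qed.

End Finiteness.

(** * Outward edges and their extension to ends *)

Section Extension.
Variable G : graph.
Hypotheses (Gtree : is_tree G) (Gends : no_dead_ends G).
Local Open Scope nat_scope.

(** The origins of the edges of an infinite chain starting with [e] form a non-backtracking path. *)
Lemma dplus_neq0 (e : edge G) : dplus e !=set0.
Proof.
have [c [c0 cS]] := Gends e.
have np : nb_path (fun n => iota_e (c n)).
  split=> n; first by rewrite (cS n).1; apply: (valP (c n)).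
  move=> cc; apply: (cS n).2; apply: edge_inj; first exact: (cS n).1.
  by rewrite -(cS n.+1).1.
have [w wP] := nb_path_ray Gtree np; exists w; apply/(dplusE Gtree).
by rewrite -c0 wP (cS 0).1.
Qed.

(** For an end [w'] beyond [e'], the ray from the origin of [e] starts with [e], since [e'] does not
    turn back; [ray_cat] then prepends the segment from [o]. *)
Lemma level_edges_follows (o : G) n e e' :
  level_edges Gtree o n e -> follows e e' -> level_edges Gtree o n.+1 e'.
Proof.
move=> [w _ <-] [ie' ne']; have [w' /(dplusE Gtree) e'w'] := dplus_neq0 e'.
set v := ray o w n; have vw' : ray v w' 1 = ray o w n.+1.
  rewrite (@ray_cons G Gtree v (iota_e e') w' 0) ?ray0 ?ie'//.
    exact: (nb_ray Gtree _ _).1.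
  move=> t; apply: ne'; apply: edge_inj => //.
  by rewrite -e'w' ie' t.
have ww' := ray_cat Gtree vw'.
exists w' => //; apply: edge_inj; first by rewrite ie'.
rewrite -e'w' ie'; change (ray o w' n.+2 = ray (ray o w n.+1) w' 1).
by rewrite -ww' ray_shift// addn1.
Qed.

Lemma level_edges_parent (o : G) n e' : level_edges Gtree o n.+1 e' ->
  exists2 e, level_edges Gtree o n e & follows e e'.
Proof.
move=> [w _ <-]; exists (edge_at Gtree o w n); first by exists w.
by split=> // /(congr1 (@tau_e G)); apply: (nb_ray Gtree _ _).2.
Qed.

Lemma level_edges_inj (o : G) n (e1 e2 : edge G) : level_edges Gtree o n e1 ->
  level_edges Gtree o n e2 -> tau_e e1 = tau_e e2 -> e1 = e2.
Proof.
move=> [w1 _ <-] [w2 _ <-] t12; apply: edge_inj => //.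
change (ray o w1 n = ray o w2 n); by have [_ ->] := ray_meet Gtree t12.
Qed.

Lemma level_edges_dplus (o : G) n e w :
  level_edges Gtree o n e -> dplus e w <-> edge_at Gtree o w n = e.
Proof.
move=> [w' _ <-]; split=> [/dplus_edge_at ww'|<-]; last exact/dplus_edge_at.
apply: edge_inj => //; change (ray o w n = ray o w' n).
by have [_ ->] := ray_meet Gtree ww'.
Qed.

(** An edge at vertex [n] of a ray either returns to vertex [n - 1] or follows the edge by which the
    ray arrived; at [o] itself every edge is outward. *)
Lemma level_edges_step (o : G) w n e : iota_e e = ray o w n ->
  level_edges Gtree o n e \/
  exists2 m, n = m.+1 & level_edges Gtree o m (op_edge e).
Proof.
case: n => [|n] ie.
  left; have [w' /(dplusE Gtree) ew'] := dplus_neq0 e.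
  exists w' => //; rewrite ray0// in ie.
  by apply: edge_inj; rewrite /= -?ew' ie // [LHS]ray0.
have [te|te] := pselect (tau_e e = ray o w n).
  right; exists n => //; exists w => //.
  by apply: edge_inj; [rewrite [RHS]te|rewrite [RHS]ie].
left; apply: (@level_edges_follows o n (edge_at Gtree o w n)).
  by exists w.
by split=> // eop; apply: te; rewrite eop.
Qed.

(** By induction along a walk from [o], every vertex lies on a ray from [o]; then [level_edges_step]
    applies. *)
Lemma edge_level (o : G) e : exists n,
  level_edges Gtree o n e \/ level_edges Gtree o n (op_edge e).
Proof.
suff [w [n ie]] : exists w n, iota_e e = ray o w n.
  case: (level_edges_step ie) => [|[m _]] H; first by exists n; left.
  by exists m; right.
have [w0 _] := dplus_neq0 e.
have [s [os <-]] := adj_conn o (iota_e e).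
have : exists w n, o = ray o w n by exists w0, 0; rewrite ray0.
elim: s {1 2 4}o os => [//|y s IHs] x /= /andP[xy ys] [w [n xE]].
apply: IHs ys _.
pose a : edge G := exist (fun p : G * G => adj p.1 p.2) (x, y) xy.
have [[w' _ aE]|[m _ [w' _ aE]]] := @level_edges_step o w n a xE.
  by exists w', n.+1; rewrite -[RHS]/(tau_e (edge_at Gtree o w' n)) aE.
by exists w', m; rewrite -[RHS]/(iota_e (edge_at Gtree o w' m)) aE.
Qed.

End Extension.

(** * Sums with finite support *)

Section FiniteSupportSums.

Lemma fsbig_single (V : nmodType) (I : choiceType) (A : set I) (i0 : I)
    (F : I -> V) :
  A i0 -> (forall i, A i -> i <> i0 -> F i = 0) -> \sum_(i \in A) F i = F i0.
Proof.
move=> Ai0 F0; have <- : \sum_(i \in [set i0]) F i = F i0 by rewrite fsbig_set1.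
apply/esym/fsbig_widen; first by move=> _ ->.
by move=> i [Ai ne]; apply: F0.
Qed.

(** The sets [S i] partition [B]: the inner sums are extended by zero to [B], and after the exchange
    each [j] keeps one term. *)
Lemma fsbig_bigcup_disjoint (V : nmodType) (I J : choiceType) (A : set I)
    (B : set J) (S : I -> set J) (F : J -> V) :
  finite_set A -> finite_set B ->
  (forall i, A i -> S i `<=` B) -> (forall j, B j -> exists2 i, A i & S i j) ->
  (forall i i' j, A i -> A i' -> S i j -> S i' j -> i = i') ->
  \sum_(j \in B) F j = \sum_(i \in A) \sum_(j \in S i) F j.
Proof.
move=> finA finB SB BS S1.
have -> : \sum_(i \in A) \sum_(j \in S i) F j =
    \sum_(i \in A) \sum_(j \in B) if j \in S i then F j else 0.
  apply: eq_fsbigr => i /set_mem Ai; rewrite -fsbig_mkcondr.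
  by rewrite (setIidr (SB i Ai)).
rewrite exchange_fsbig//; apply: eq_fsbigr => j /set_mem Bj.
have [i Ai Sij] := BS j Bj; rewrite (fsbig_single Ai); first by rewrite mem_set.
move=> i' Ai' ne; rewrite memNset// => Si'j; apply: ne.
exact: S1 Ai' Ai Si'j Sij.
Qed.

Lemma raddf_fsum (U V : nmodType) (I : choiceType) (f : {additive U -> V})
    (A : set I) (F : I -> U) : finite_set A ->
  f (\sum_(i \in A) F i) = \sum_(i \in A) f (F i).
Proof. by move=> finA; rewrite !fsbig_finite// raddf_sum. Qed.

End FiniteSupportSums.

(** * Poisson kernels as locally constant functions *)

Section Kernel.
Variables (R : realType) (G : graph) (o : G) (z : R[i]).
Hypothesis Gtree : is_tree G.
Local Notation C := (R[i]^o).

(** A named form of the coercion, to carry the structure of a linear map. *)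
Definition lc_eval (mu : lc_dual R G) : lc_fun R G -> C := val mu.

Lemma lc_eval_linear mu : linear (lc_eval mu).
Proof. exact: asboolW (valP mu). Qed.

HB.instance Definition _ mu :=
  GRing.isLinear.Build R[i] (lc_fun R G) C _ (lc_eval mu) (lc_eval_linear mu).

(** Built with the same [insubd] as [lc_integral], so that [edge_poissonE] holds by conversion. *)
Definition poisson_kernel (e : edge G) : lc_fun R G :=
  insubd 0 (fun w => z ^ bracket o (iota_e e) w * \1_(dplus e) w).

Lemma edge_poissonE mu e :
  edge_poisson o z mu e = lc_eval mu (poisson_kernel e).
Proof. by []. Qed.

(** Ends near [w0] keep a meeting point of the two rays, hence the bracket, and the first step from
    [iota_e e]. The integrand is thus locally constant and the default 0 does not occur. *)
Lemma poisson_kernelE e w :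
  val (poisson_kernel e) w = z ^ bracket o (iota_e e) w * \1_(dplus e) w.
Proof.
rewrite /poisson_kernel insubdK//; apply/asboolP => w0.
have [i [j ij]] := ray_meet_tail Gtree o (iota_e e) w0.
near=> w'.
have oi : ray o w' i = ray o w0 i by near: w'; apply: near_ray.
have ej : ray (iota_e e) w' j = ray (iota_e e) w0 j.
  by near: w'; apply: near_ray.
have e1 : ray (iota_e e) w' 1 = ray (iota_e e) w0 1.
  by near: w'; apply: near_ray.
have ij' : ray o w' i = ray (iota_e e) w' j by rewrite oi ej.
rewrite (bracketE Gtree ij) (bracketE Gtree ij') !indicE.
congr (_ * (_ : bool)%:R).
by apply/idP/idP => /set_mem/(dplusE Gtree) H; apply/mem_set/(dplusE Gtree);
  rewrite -H.
Unshelve. all: by end_near. Qed.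

(** On [dplus e] the ray from [o] reaches the origin of [e] at position [n], so the bracket is
    [n - 0]. *)
Lemma poisson_kernel_level n e w : level_edges Gtree o n e ->
  val (poisson_kernel e) w = z ^+ n * (edge_at Gtree o w n == e)%:R.
Proof.
move=> en; rewrite poisson_kernelE indicE.
have [ew|ew] := pselect (dplus e w); last first.
  rewrite memNset// mulr0; case: eqP; last by rewrite mulr0.
  by move/(level_edges_dplus w en).
rewrite mem_set//; have we := (level_edges_dplus w en).1 ew.
rewrite we eqxx (@bracketE _ Gtree _ _ _ n 0) ?subr0//.
by rewrite ray0// -we.
Qed.

Lemma sum_lc_funE (I : choiceType) (A : set I) (F : I -> lc_fun R G) w :
  finite_set A -> val (\sum_(i \in A) F i) w = \sum_(i \in A) val (F i) w.
Proof. by move=> finA; rewrite raddf_fsum// !fsbig_finite// fct_sumE. Qed.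

Lemma lc_fun_linearE a (g h : lc_fun R G) w :
  val (a *: g + h) w = a * val g w + val h w.
Proof. by rewrite linearP. Qed.

(** Pointwise at [w]: in [dplus e] only the next edge of the ray contributes, with bracket larger by
    one; outside, no follower contributes, since [e] could be prepended to its rays. *)
Lemma poisson_kernel_follows (Gbounded : bounded_degree G) (z0 : z != 0) e :
  \sum_(e' \in [set e' | follows e e']) poisson_kernel e' =
  z *: poisson_kernel e.
Proof.
apply: val_inj; apply: boolp.funext => w.
rewrite sum_lc_funE; last exact: finite_follows.
rewrite -[RHS]/(z * val (poisson_kernel e) w) poisson_kernelE indicE.
have [ew|ew] := pselect (dplus e w); last first.
  rewrite memNset// !mulr0; apply: fsbig1 => e' [ie' ne'].
  rewrite poisson_kernelE indicE memNset ?mulr0// => e'w; apply: ew.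
  apply/(dplusE Gtree); rewrite (@ray_cons _ Gtree _ (tau_e e) w 0) ?ray0//.
    exact: (valP e).
  rewrite -ie' (dplusE Gtree e' w).1// => te'; apply: ne'; exact: edge_inj.
(* The base point here is [iota_e e], so index 1 is the edge right after [e]. *)
have fe : follows e (edge_at Gtree (iota_e e) w 1).
  split; first exact: (dplusE Gtree e w).1.
  move=> /(congr1 (@tau_e G)); rewrite -[RHS](ray0 Gtree _ w).
  exact: (nb_ray Gtree _ w).2.
rewrite (fsbig_single fe) => [|e' [ie' _] ne'].
  rewrite poisson_kernelE indicE !mem_set//; last exact/dplus_edge_at.
  by rewrite !mulr1 fe.1 bracket_tau// expfzDr// expr1z mulrC.
rewrite poisson_kernelE indicE memNset ?mulr0// => e'w; apply: ne'.
have tE := (dplusE Gtree e' w).1 e'w.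
have iE := (dplusE Gtree e w).1 ew.
apply: edge_inj; first by rewrite ie' -iE.
by rewrite -tE ie' -iE ray_shift.
Qed.

End Kernel.

(** * Injectivity and the eigenvalue equation *)

Section Transform.
Variables (R : realType) (G : graph) (o : G) (z : R[i]).
Hypotheses (Gtree : is_tree G) (Gbounded : bounded_degree G).
Hypotheses (Gends : no_dead_ends G) (z0 : z != 0).
Local Notation C := (R[i]^o).
Local Notation level := (level_edges Gtree o).
Local Notation kernel := (poisson_kernel o z).

(** A sample point of the piece [dplus e]. *)
Definition end_of (e : edge G) : boundary G :=
  projT1 (cid (dplus_neq0 Gtree Gends e)).

Lemma dplus_end_of e : dplus e (end_of e).
Proof. exact: (projT2 (cid (dplus_neq0 Gtree Gends e))). Qed.

Lemma edge_at_end_of n e : level n e -> edge_at Gtree o (end_of e) n = e.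
Proof. by move=> en; apply/(level_edges_dplus _ en)/dplus_end_of. Qed.

(** The index is [n.+1] because level [n] edges end at vertex [n.+1]: [g] is constant on their
    pieces. *)
Definition level_determined n (g : boundary G -> C) :=
  forall w w', ray o w n.+1 = ray o w' n.+1 -> g w = g w'.

Lemma level_determinedW m n g :
  (m <= n)%N -> level_determined m g -> level_determined n g.
Proof.
move=> mn gm w w' /(ray_meet Gtree)[_ ww']; exact/gm/ww'.
Qed.

Lemma lc_level_determined (g : lc_fun R G) :
  exists n, level_determined n (val g).
Proof.
have [n nP] := loc_const_ray Gtree Gbounded o (asboolW (valP g)).
exists n => w w' /(ray_meet Gtree)[_ ww']; exact/nP/ww'.
Qed.

(** Level [n] kernels are [z ^+ n] times the indicators of disjoint pieces covering the boundary. *)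
Lemma lc_fun_kernel_sum n (g : lc_fun R G) : level_determined n (val g) ->
  g = \sum_(e \in level n) (val g (end_of e) / z ^+ n) *: kernel e.
Proof.
move=> gn; apply: val_inj; apply: boolp.funext => w.
rewrite sum_lc_funE; last exact: finite_level_edges.
have wn : level n (edge_at Gtree o w n) by exists w.
rewrite (fsbig_single wn) => [|e en ne].
  rewrite -[RHS]/(_ * val (kernel _) w) (poisson_kernel_level z _ wn).
  rewrite eqxx mulr1.
  rewrite divfK ?expf_neq0//; apply: gn.
  by apply/esym/(dplus_edge_at Gtree); apply: dplus_end_of.
rewrite -[LHS]/(_ * val (kernel _) w) (poisson_kernel_level z _ en).
by case: eqP => [/esym//|_]; rewrite !mulr0.
Qed.

Lemma edge_poisson_inj : injective (@edge_poisson R G o z).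
Proof.
move=> mu nu munu; apply: val_inj; apply: boolp.funext => g.
rewrite -[LHS]/(lc_eval mu g) -[RHS]/(lc_eval nu g).
have [n /lc_fun_kernel_sum ->] := lc_level_determined g.
have fin := finite_level_edges Gtree Gbounded o n.
rewrite !raddf_fsum//; apply: eq_fsbigr => e _.
rewrite /= !linearZ.
exact: (congr1 (fun f : edge_maps R G => _ *: f e) munu).
Qed.

Lemma edge_poisson_eigen mu :
  edge_laplacian (edge_poisson o z mu) = z *: edge_poisson o z mu.
Proof.
apply: boolp.funext => e; rewrite /edge_laplacian.
have fin := finite_follows Gbounded e.
rewrite -[RHS]/(z *: edge_poisson o z mu e) edge_poissonE -linearZ.
by rewrite -(poisson_kernel_follows o Gtree Gbounded z0) raddf_fsum.
Qed.

(** The followers of an inward edge are outward or inward of smaller level, so the eigenvalue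
    equation yields its value after division by [z]. *)
Lemma eigen_ext (f g : edge_maps R G) :
  edge_laplacian f = z *: f -> edge_laplacian g = z *: g ->
  (forall n e, level n e -> f e = g e) -> f = g.
Proof.
move=> fz gz fg; apply: boolp.funext => e.
have [n [|]] := edge_level Gtree Gends o e; first exact: fg.
elim/ltn_ind: n e => n IHn e [w _ we].
have zfg : z * f e = z * g e.
  rewrite -[LHS]/((z *: f) e) -[RHS]/((z *: g) e) -fz -gz; apply: eq_fsbigr.
  move=> e' /set_mem[ie' _].
  have ie'w : iota_e e' = ray o w n.
    by rewrite ie' -[RHS]/(iota_e (edge_at Gtree o w n)) we.
  have [|[m nm]] := level_edges_step Gtree Gends ie'w; first exact: fg.
  by apply: IHn; rewrite nm.
exact: (mulfI z0).
Qed.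

(** * The distribution attached to an eigenfunction *)

Section Inverse.
Variable f : edge_maps R G.
Hypothesis fz : edge_laplacian f = z *: f.

(** A Riemann sum of [g] in which the piece [dplus e] has mass [f e / z ^+ n]. *)
Definition level_sum n (g : boundary G -> C) : C :=
  \sum_(e \in level n) g (end_of e) / z ^+ n * f e.

(** Level [n.+1] edges are grouped by the edge they follow; the eigenvalue equation adds their
    masses to that of the parent. *)
Lemma level_sumS n g : level_determined n g -> level_sum n.+1 g = level_sum n g.
Proof.
move=> gn; rewrite /level_sum.
rewrite (@fsbig_bigcup_disjoint _ _ _ (level n) _
  (fun e => [set e' | follows e e'])).
- apply: eq_fsbigr => e /set_mem en.
  have fe : z * f e = \sum_(e' \in [set e' | follows e e']) f e'.
    by rewrite -[LHS]/((z *: f) e) -fz.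
  have -> : g (end_of e) / z ^+ n * f e = g (end_of e) / z ^+ n.+1 * (z * f e).
    by rewrite mulrA; congr (_ * _); rewrite exprSr invfM [in RHS]mulrA divfK.
  rewrite fe mulr_fsumr; apply: eq_fsbigr => e' /set_mem ee'; congr (_ / _ * _).
  (* Both sample ends pass through [tau_e e] at position [n.+1]. *)
  apply: gn; have e'n := level_edges_follows Gends en ee'.
  rewrite -[LHS]/(iota_e (edge_at Gtree o (end_of e') n.+1)) edge_at_end_of//.
  rewrite -[RHS]/(tau_e (edge_at Gtree o (end_of e) n)) edge_at_end_of//.
  exact: ee'.1.
- exact: finite_level_edges.
- exact: finite_level_edges.
- by move=> e en e'; apply: level_edges_follows.
- by move=> e' /level_edges_parent[e en ee']; exists e.
- move=> e1 e2 e' e1n e2n [ie1 _] [ie2 _].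
  by apply: (level_edges_inj e1n e2n); rewrite -ie1.
Qed.

Lemma level_sum_stable m n g :
  (m <= n)%N -> level_determined m g -> level_sum n g = level_sum m g.
Proof.
move=> /subnK <-; elim: (n - m)%N => // k IHk gm.
rewrite addSn level_sumS ?IHk//; apply: level_determinedW gm; exact: leq_addl.
Qed.

Definition inverse_fun (g : lc_fun R G) : C :=
  level_sum (projT1 (cid (lc_level_determined g))) (val g).

Lemma inverse_funE n g :
  level_determined n (val g) -> inverse_fun g = level_sum n (val g).
Proof.
move=> gn; rewrite /inverse_fun; case: cid => m /= gm.
have [mn|/ltnW nm] := leqP m n; first by rewrite (level_sum_stable mn).
by rewrite (level_sum_stable nm).
Qed.

Lemma inverse_fun_linear : linear inverse_fun.
Proof.
move=> a g h; have [ng gn] := lc_level_determined g.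
have [nh hn] := lc_level_determined h.
pose n := maxn ng nh.
have {}gn : level_determined n (val g).
  by apply: level_determinedW gn; apply: leq_maxl.
have {}hn : level_determined n (val h).
  by apply: level_determinedW hn; apply: leq_maxr.
have ghn : level_determined n (val (a *: g + h)).
  move=> w w' ww'; rewrite !lc_fun_linearE.
  by rewrite (gn _ _ ww') (hn _ _ ww').
rewrite (inverse_funE gn) (inverse_funE hn) (inverse_funE ghn) /level_sum.
rewrite -[RHS]/(a * _ + _) mulr_fsumr -fsbig_split;
  last exact: finite_level_edges.
apply: eq_fsbigr => e _; rewrite lc_fun_linearE.
by rewrite !mulrDl !mulrA.
Qed.

Definition inverse_dual : lc_dual R G :=
  exist _ inverse_fun (asboolT inverse_fun_linear).

(** Both sides are eigenfunctions, so outward edges suffice; for these the level [n] sum of the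
    kernel reduces to the term of [e], where [z ^+ n] cancels. *)
Lemma inverse_dualK : edge_poisson o z inverse_dual = f.
Proof.
apply: eigen_ext => //; first exact: edge_poisson_eigen.
move=> n e en; rewrite edge_poissonE -[LHS]/(inverse_fun (kernel e)).
rewrite (@inverse_funE n); last first.
  move=> w w' ww'; rewrite !(poisson_kernel_level z _ en).
  congr (_ * (_ == _)%:R); apply: edge_inj => //.
  change (ray o w n = ray o w' n); by have [_ ->] := ray_meet Gtree ww'.
rewrite /level_sum (fsbig_single en) => [|e' e'n ne].
  rewrite (poisson_kernel_level z _ en) edge_at_end_of// eqxx mulr1.
  by rewrite divff ?mul1r// expf_neq0.
rewrite (poisson_kernel_level z _ en) edge_at_end_of//.
by case: eqP => // _; rewrite mulr0 !mul0r.
Qed.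

End Inverse.
End Transform.

Theorem propositionA (R : realType) (G : graph) (o : G) (z : R[i])
    (Gtree : is_tree G) (Gbounded : bounded_degree G)
    (Gends : no_dead_ends G) (z0 : z != 0) :
  [/\ linear (@edge_poisson R G o z),
      injective (@edge_poisson R G o z) &
      range (@edge_poisson R G o z) =
        [set f : edge_maps R G | edge_laplacian f = z *: f]].
Proof.
(* Linearity is by computation: [mu] is evaluated at a fixed kernel, and operations on functionals
   are pointwise. *)
split; [by []|exact: edge_poisson_inj|].
apply/seteqP; split=> [_ [mu _ <-]|f fz]; first exact: edge_poisson_eigen.
exists (inverse_dual o Gtree Gbounded Gends z0 fz) => //.
exact: inverse_dualK.
Qed.
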